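(* It is not true that for every concave function $f:[0,\infty)\to\mathbb{R}$ with $f(0)\ge0$ and all positive semidefinite $A,B\in\mathbb{M}_n$ there exist unitaries $U,V\in\mathbb{M}_n$ with $$f(A+B)\le Uf(A)U^*+Vf(B)V^*.$$ More precisely, for the concave function $f(t)=t-t^2$ there exist positive semidefinite $A,B\in\mathbb{M}_2$ such that no unitaries $U,V\in\mathbb{M}_2$ satisfy this inequality.
   Context: $\mathbb{M}_n$ is the space of $n\times n$ complex matrices. For a positive semidefinite matrix $X$, $f(X)$ is defined by the spectral functional calculus. For Hermitian matrices, $X\le Y$ means $Y-X$ is positive semidefinite. *)

(* Defs.v *)
From HB Require Import structures.
From mathcomp Require Import all_boot all_order all_algebra.
From mathcomp Require Import complex.
From mathcomp Require Import classical_sets reals convex.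

Set Implicit Arguments.
Unset Strict Implicit.
Unset Printing Implicit Defensive.

Import Order.TTheory GRing.Theory Num.Theory.

Local Open Scope ring_scope.
Local Open Scope sesquilinear_scope.
Local Open Scope complex_scope.

(* A function [0, oo) -> R is represented by a total function R -> R whose
   values at negative arguments are left unconstrained. *)
Definition concave_on_nonneg (R : realType) (f : R -> R) : Prop :=
  convex_function (E := R^o) [set t | 0 <= t]%classic (fun t => - f t).

(* On R[i], 0 <= z means that z is real and nonnegative. *)
Definition psdmx (R : realType) (n : nat) (A : 'M[R[i]]_n) : Prop :=
  A \is hermsymmx /\ forall x : 'cV[R[i]]_n, 0 <= (x ^t* *m A *m x) 0 0.

Definition loewner_le (R : realType) (n : nat) (X Y : 'M[R[i]]_n) : Prop :=
  psdmx (Y - X).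

(* If A = P^-1 D P with P unitary and D diagonal, then f(A) = P^-1 f(D) P; the
   result does not depend on the diagonalization. Only meaningful for
   Hermitian A, whose eigenvalues are real, so that complex.Re merely
   retypes them from R[i] to R. *)
Definition spectral_fun (R : realType) (n : nat) (f : R -> R)
    (A : 'M[R[i]]_n) : 'M[R[i]]_n :=
  invmx (spectralmx A)
  *m diag_mx (map_mx (fun z : R[i] => (f (complex.Re z))%:C) (spectral_diag A))
  *m spectralmx A.

(* Main.v *)
(* For f(t) = t - t^2 one has f(A) = A - A^2. Hence f vanishes on projections,
   and f(A + B) = - (AB + BA) when A and B are projections, so the inequality
   says AB + BA >= 0. This fails for two non-commuting projections, such as the
   ones onto the lines spanned by (1, 0) and (1, 1). *)

Require Import Defs.
From HB Require Import structures.
From mathcomp Require Import all_boot all_order all_algebra.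
From mathcomp Require Import complex.
From mathcomp Require Import classical_sets reals convex.
From mathcomp Require Import interval_inference ring.

Import Order.TTheory GRing.Theory Num.Theory.

Local Open Scope ring_scope.
Local Open Scope sesquilinear_scope.
Local Open Scope complex_scope.

Lemma hermsymmxP {C : numClosedFieldType} {n : nat} {A : 'M[C]_n} :
  reflect (A ^t* = A) (A \is hermsymmx).
Proof.
rewrite is_hermitianmxE expr0 scale1r eq_sym; exact: eqP.
Qed.

Lemma hermsymmxD {C : numClosedFieldType} {n : nat} {A B : 'M[C]_n} :
  A \is hermsymmx -> B \is hermsymmx -> A + B \is hermsymmx.
Proof.
move=> /hermsymmxP hA /hermsymmxP hB; apply/hermsymmxP.
by rewrite linearD map_mxD hA hB.
Qed.

(** Since [A = A ^t* *m A], the quadratic form at [x] is the squared norm of [A *m x], a sum of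
    terms [|z|^2]. *)
Lemma psdmx_projection {R : realType} {n : nat} {A : 'M[R[i]]_n} :
  A \is hermsymmx -> A *m A = A -> psdmx A.
Proof.
move=> hA AA; split=> // x.
have -> : x ^t* *m A *m x = (A *m x) ^t* *m (A *m x).
  rewrite trmx_mul map_mxM; move/hermsymmxP: hA => ->.
  by rewrite !mulmxA -(mulmxA _ A A) AA.
rewrite mxE; apply: sumr_ge0 => k _.
by rewrite !mxE mulrC -normCK exprn_ge0.
Qed.

(** Conjugation by [P] respects products, because the inner factor [P *m invmx P] cancels in the
    square; this transfers the computation from the diagonal matrix to [A]. *)
Lemma conj_sub_sqr (C : comUnitRingType) (n : nat) (P D : 'M[C]_n) :
  P \in unitmx ->
  let A := invmx P *m D *m P in invmx P *m (D - D *m D) *m P = A - A *m A.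
Proof.
move=> uP A; rewrite mulmxBr mulmxBl /A; congr (_ - _).
by rewrite !mulmxA mulmxK.
Qed.

Lemma spectral_fun_sub_sqr {R : realType} {n : nat} {A : 'M[R[i]]_n} :
  A \is hermsymmx -> spectral_fun (fun t => t - t ^+ 2) A = A - A *m A.
Proof.
move=> hA; rewrite /spectral_fun.
have /orthomx_spectralP eA := hermitian_normalmx hA.
have /mxOverP rd := hermitian_spectral_diag_real hA.
set P := spectralmx A in eA *; set d := spectral_diag A in eA rd *.
(* On a diagonal matrix [t - t^2] acts entrywise. The eigenvalues of a Hermitian matrix are real, so
   taking [complex.Re] and embedding back returns each of them unchanged. *)
have -> : diag_mx (map_mx (fun z : R[i] =>
    (complex.Re z - complex.Re z ^+ 2)%:C) d)
  = diag_mx d - diag_mx d *m diag_mx d.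
  rewrite mulmx_diag -raddfB; congr diag_mx; apply/rowP=> j.
  by rewrite !mxE rmorphB rmorphXn /= RRe_real // expr2.
by rewrite conj_sub_sqr ?spectral_unit // -eA.
Qed.

Lemma spectral_fun_sub_sqr_projection {R : realType} {n : nat}
    {A : 'M[R[i]]_n} :
  A \is hermsymmx -> A *m A = A -> spectral_fun (fun t => t - t ^+ 2) A = 0.
Proof. by move=> hA AA; rewrite spectral_fun_sub_sqr // AA subrr. Qed.

(** Both terms on the right vanish whatever [U] and [V] are, which removes the unknown unitaries
    from the problem and leaves a condition on [A] and [B] alone. *)
Lemma loewner_le_sub_sqr_projections {R : realType} {n : nat}
    {A B U V : 'M[R[i]]_n} :
  A \is hermsymmx -> A *m A = A -> B \is hermsymmx -> B *m B = B ->
  loewner_le (spectral_fun (fun t => t - t ^+ 2) (A + B))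
    (U *m spectral_fun (fun t => t - t ^+ 2) A *m U ^t*
     + V *m spectral_fun (fun t => t - t ^+ 2) B *m V ^t*) ->
  psdmx (A *m B + B *m A).
Proof.
move=> hA AA hB BB; rewrite /loewner_le.
rewrite (spectral_fun_sub_sqr_projection hA AA).
rewrite (spectral_fun_sub_sqr_projection hB BB).
rewrite (spectral_fun_sub_sqr (hermsymmxD hA hB)).
(* What remains is [(A + B)^2 - (A + B)]; expanding the square and using idempotence cancels [A + B]
   and leaves the two cross terms. *)
rewrite !mulmx0 !mul0mx addr0 sub0r opprB mulmxDl !mulmxDr AA BB.
by rewrite (addrC A (A *m B)) addrACA addrK.
Qed.

Lemma concave_sub_sqr (R : realType) :
  concave_on_nonneg (fun t : R => t - t ^+ 2).
Proof.
have conv_sub_sqr (p x y : R) : 0 <= p -> p <= 1 ->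
    - ((p * x + (1 - p) * y) - (p * x + (1 - p) * y) ^+ 2)
    <= p * - (x - x ^+ 2) + (1 - p) * - (y - y ^+ 2).
  move=> p0 p1; rewrite -subr_ge0.
  set gap := (X in 0 <= X).
  (* The convexity defect of [t^2 - t] comes from the square only, the linear part being affine: it
     is the variance of the two-point distribution with weights [p] and [1 - p]. *)
  have -> : gap = p * (1 - p) * (x - y) ^+ 2 by rewrite /gap; ring.
  by rewrite mulr_ge0 ?sqr_ge0 // mulr_ge0 ?subr_ge0.
move=> t x y _ _; rewrite !convRE.
by apply: conv_sub_sqr; [exact: ge0 | exact: le1].
Qed.

Definition axis_proj (R : realType) : 'M[R[i]]_2 := delta_mx 0 0.
(** This is [v v^*] for the unit vector [v = (1, 1) / sqrt 2], so every entry is [1/2]. *)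
Definition diag_proj (R : realType) : 'M[R[i]]_2 := const_mx 2^-1.

Lemma hermsymmx_axis_proj (R : realType) : axis_proj R \is hermsymmx.
Proof.
by apply/hermsymmxP; rewrite /axis_proj trmx_delta map_delta_mx.
Qed.

Lemma hermsymmx_diag_proj (R : realType) : diag_proj R \is hermsymmx.
Proof.
apply/hermsymmxP; rewrite /diag_proj trmx_const map_const_mx.
by rewrite fmorphV rmorph_nat.
Qed.

Lemma axis_proj_idem (R : realType) : axis_proj R *m axis_proj R = axis_proj R.
Proof. exact: mul_delta_mx. Qed.

Lemma diag_proj_idem (R : realType) : diag_proj R *m diag_proj R = diag_proj R.
Proof.
apply/matrixP=> j k; rewrite !mxE !big_ord_recl big_ord0 !mxE.
by field.
Qed.

Lemma axis_diag_anticommutator_not_psd (R : realType) :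
  ~ psdmx (axis_proj R *m diag_proj R + diag_proj R *m axis_proj R).
Proof.
(* The anticommutator has rows [(1, 1/2)] and [(1/2, 0)]. Its form at a real vector [(a, b)] is
   [a^2 + a b], which is [-1] at [(1, -2)]. *)
set x : 'cV[R[i]]_2 := \col_i (if i == 0 then 1 else -2).
case=> _ /(_ x).
set S := _ + _; have -> : (x ^t* *m S *m x) 0 0 = -1.
  rewrite /S !(mxE, big_ord_recl, big_ord0) /= conjC1 rmorphN rmorph_nat.
  by field.
by rewrite oppr_ge0 ler10.
Qed.

Theorem mainTheorem17 (R : realType) :
  (~ forall f : R -> R, concave_on_nonneg f -> 0 <= f 0 ->
       forall (n : nat) (A B : 'M[R[i]]_n), (0 < n)%N -> psdmx A -> psdmx B ->
       exists U V : 'M[R[i]]_n,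
         [/\ U \is unitarymx, V \is unitarymx &
             loewner_le (spectral_fun f (A + B))
               (U *m spectral_fun f A *m U ^t*
                + V *m spectral_fun f B *m V ^t*)])
  /\
  (let f : R -> R := fun t => t - t ^+ 2 in
   [/\ concave_on_nonneg f, 0 <= f 0 &
       exists A B : 'M[R[i]]_2,
         [/\ psdmx A, psdmx B &
             ~ exists U V : 'M[R[i]]_2,
                 [/\ U \is unitarymx, V \is unitarymx &
                     loewner_le (spectral_fun f (A + B))
                       (U *m spectral_fun f A *m U ^t*
                        + V *m spectral_fun f B *m V ^t*)]]]).
Proof.
have f_concave := concave_sub_sqr R.
have f0 : 0 <= 0 - 0 ^+ 2 :> R by rewrite expr0n subr0.
(* For any [U] and [V], the inequality would make the anticommutator of the two projections positive
   semidefinite. This one implication refutes both the universal claim, taken at [n = 2], and the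
   explicit instance. *)
have no_UV (U V : 'M[R[i]]_2) :=
  @loewner_le_sub_sqr_projections R 2 (axis_proj R) (diag_proj R) U V
    (hermsymmx_axis_proj R) (axis_proj_idem R)
    (hermsymmx_diag_proj R) (diag_proj_idem R).
have psd1 := psdmx_projection (hermsymmx_axis_proj R) (axis_proj_idem R).
have psd2 := psdmx_projection (hermsymmx_diag_proj R) (diag_proj_idem R).
split.
  move=> all_f.
  have [U [V [_ _ /no_UV]]] := all_f _ f_concave f0 2%N _ _ isT psd1 psd2.
  exact: axis_diag_anticommutator_not_psd.
move=> f; split=> //; exists (axis_proj R), (diag_proj R); split=> //.
by case=> U [V [_ _ /no_UV]]; exact: axis_diag_anticommutator_not_psd.
Qed.
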